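(* Let $(Y,*,\circ)$ and $(K,*,\circ)$ be digroups and suppose that there are two group antihomomorphisms $\phi_*\colon (Y,* )\to\mathrm{Aut}(K,* )$, $y\mapsto\phi_{*y}$, and $\phi_\circ\colon (Y,\circ)\to\mathrm{Aut}(K,\circ)$, $y\mapsto\phi_{\circ y}$, and a mapping $\Lambda\colon Y\to S_K$, $y\mapsto\Lambda_y$, with $\Lambda_1=\mathrm{Id}$ (that is, a morphism of pointed sets $(Y,1)\to(S_K,\mathrm{Id})$). On the cartesian product $Y\times K$ define two operations by $$(y,k)+(y',k')=\bigl(y*y',\ (\Lambda_{y*y'})^{-1}\bigl(\phi_{*y'}(\Lambda_y(k))*\Lambda_{y'}(k')\bigr)\bigr)$$ and $$(y,k)\circ(y',k')=\bigl(y\circ y',\ \phi_{\circ y'}(k)\circ k'\bigr)$$ for every $y,y'\in Y$ and $k,k'\in K$. Then $(Y\times K,+,\circ)$ is a digroup.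
   Context: A digroup is a triplet $(D,*,\circ)$ where $(D,* )$ and $(D,\circ)$ are groups (on the same set) with the same identity, denoted $1$. $\mathrm{Aut}(K,* )$ and $\mathrm{Aut}(K,\circ)$ are the groups of automorphisms of the groups $(K,* )$ and $(K,\circ)$, with composition of mappings as operation. $S_K$ is the symmetric group of all permutations of the set $K$. A group antihomomorphism is a mapping $f$ with $f(ab)=f(b)f(a)$. *)

(* Defs.v *)
From HB Require Import structures.
From mathcomp Require Import ssreflect ssrfun ssrbool eqtype choice monoid.
From mathcomp Require Import boolp.

Set Implicit Arguments.
Unset Strict Implicit.
Unset Printing Implicit Defensive.

Local Open Scope group_scope.

(* The HB class [Group.axioms_ D] is the type of group structures on [D]. It
   also contains an [eqType] and a [choiceType] structure; every type has these
   by [gen_eqMixin] and [gen_choiceMixin], so they do not restrict [D]. The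
   copies in the two group structures of a digroup need not agree. *)
Record digroup (D : Type) := Digroup {
  star_class : Group.axioms_ D;
  circ_class : Group.axioms_ D;
  same_one : @one (Group.Pack star_class) = @one (Group.Pack circ_class)
}.

Definition starG D (d : digroup D) : groupType := Group.Pack (star_class d).
Definition circG D (d : digroup D) : groupType := Group.Pack (circ_class d).

Definition digroup_one D (d : digroup D) : D := @one (starG d).
Definition star D (d : digroup D) : D -> D -> D := @mul (starG d).
Definition circ D (d : digroup D) : D -> D -> D := @mul (circG d).

Notation "x *[ d ] y" := (star d x y)
  (at level 40, left associativity, format "x  *[ d ]  y") : group_scope.
Notation "x \o[ d ] y" := (circ d x y)
  (at level 40, left associativity, format "x  \o[ d ]  y") : group_scope.

Record symg (T : Type) := Symg {
  symg_fun :> T -> T;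
  symg_bij : bijective symg_fun
}.

HB.instance Definition _ T := gen_eqMixin (symg T).
HB.instance Definition _ T := gen_choiceMixin (symg T).

Section SymmetricGroup.
Variable T : Type.
Implicit Types s t u : symg T.

Lemma symgP s t : s =1 t -> s = t.
Proof.
case: s t => f fB [g gB] /= /funext fg; case: _ / fg gB => gB.
by rewrite (Prop_irrelevance fB gB).
Qed.

Lemma symg_inv_subproof s : exists t, cancel s t /\ cancel t s.
Proof.
have [g sK gK] := symg_bij s.
by exists (Symg (Bijective gK sK)).
Qed.

Definition symg_one : symg T := Symg (inv_bij (fun=> erefl) : bijective id).
Definition symg_mul s t : symg T := Symg (bij_comp (symg_bij s) (symg_bij t)).
Definition symg_inv s : symg T := projT1 (cid (symg_inv_subproof s)).

Lemma symg_invP s : cancel s (symg_inv s) /\ cancel (symg_inv s) s.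
Proof. exact: projT2 (cid (symg_inv_subproof s)). Qed.

Lemma symg_mulA : associative symg_mul.
Proof. by move=> s t u; apply: symgP. Qed.
Lemma symg_mul1 : left_id symg_one symg_mul.
Proof. by move=> s; apply: symgP. Qed.
Lemma symg_mulr1 : right_id symg_one symg_mul.
Proof. by move=> s; apply: symgP. Qed.
Lemma symg_mulV : left_inverse symg_one symg_inv symg_mul.
Proof. by move=> s; apply: symgP => x /=; rewrite (symg_invP s).1. Qed.
Lemma symg_mulrV : right_inverse symg_one symg_inv symg_mul.
Proof. by move=> s; apply: symgP => x /=; rewrite (symg_invP s).2. Qed.

End SymmetricGroup.

(* The product is composition of mappings, [(s * t) x = s (t x)]; this is the
   opposite of the convention for [{perm T}]. *)
HB.instance Definition _ T := isGroup.Build (symg T)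
  (@symg_mulA T) (@symg_mul1 T) (@symg_mulr1 T) (@symg_mulV T) (@symg_mulrV T).

Lemma symgM T (s t : symg T) x : (s * t) x = s (t x).
Proof. by []. Qed.
Lemma symg1 T x : (1 : symg T) x = x.
Proof. by []. Qed.
Lemma symgK T (s : symg T) : cancel s s^-1.
Proof. exact: (symg_invP s).1. Qed.
Lemma symgVK T (s : symg T) : cancel s^-1 s.
Proof. exact: (symg_invP s).2. Qed.

Definition is_aut (G : groupType) : pred (symg G) :=
  fun s => `[< {morph s : x y / x * y} >].

Record autg (G : groupType) := Autg {
  autg_sym :> symg G;
  _ : is_aut autg_sym
}.

HB.instance Definition _ (G : groupType) := [isSub for @autg_sym G].
HB.instance Definition _ (G : groupType) := [Choice of autg G by <:].

Lemma is_aut_closed (G : groupType) : group_closed (@is_aut G).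
Proof.
split=> [|s t /asboolP sM /asboolP tM]; apply/asboolP => x y //.
rewrite !symgM -sM; congr (s _).
by apply: (can_inj (symgK t)); rewrite tM !symgVK.
Qed.

HB.instance Definition _ (G : groupType) :=
  SubChoice_isSubGroup.Build (symg G) (@is_aut G) (autg G) (@is_aut_closed G).

Lemma autg_morph (G : groupType) (s : autg G) : {morph s : x y / x * y}.
Proof. by case: s => s /= /asboolP. Qed.
Lemma autgM (G : groupType) (s t : autg G) x : (s * t) x = s (t x).
Proof. by []. Qed.

Definition antihomomorphism (G H : groupType) (f : G -> H) : Prop :=
  {morph f : x y / x * y >-> y * x}.

(* Main.v *)
(* For a right action by automorphisms, (y, k) (y', k') = (y y', phi_y'(k) k')
   is a semidirect product. The operation + is its transport along the
   bijection (y, k) |-> (y, Lambda_y(k)), and the operation \circ is the case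
   where every Lambda_y is the identity. The bijection fixes (1, 1) since
   Lambda_1 does, so both groups have identity (1, 1). *)
Require Import Defs.
From mathcomp Require Import ssreflect ssrfun ssrbool eqtype choice monoid.
From HB Require Import structures.
From mathcomp Require Import boolp.

Local Open Scope group_scope.

Lemma antihomomorphism1 {G H : groupType} {f : G -> H} :
  antihomomorphism f -> f 1 = 1.
Proof. by move=> fM; apply: (mulgI (f 1)); rewrite -fM !mulg1. Qed.

Lemma autg_one {G : groupType} (s : autg G) : s 1 = 1.
Proof. by apply: (mulgI (s 1)); rewrite -autg_morph !mulg1. Qed.

Definition twisted_mul {G H : groupType} (phi : G -> autg H) (L : G -> symg H)
    (x x' : G * H) : G * H :=
  (x.1 * x'.1, (L (x.1 * x'.1))^-1 (phi x'.1 (L x.1 x.2) * L x'.1 x'.2)).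

(* A copy of [G * H], so that the group structure below does not overlap with
   the direct product. *)
Definition twisted_prod {G H : groupType} {phi : G -> autg H} {L : G -> symg H}
  (phiM : antihomomorphism phi) (L1 : L 1 = 1) : Type := (G * H)%type.

Section TwistedProduct.
Context {G H : groupType} {phi : G -> autg H} {L : G -> symg H}.
Hypotheses (phiM : antihomomorphism phi) (L1 : L 1 = 1).

(** The inverse in the semidirect product is [(y^-1, (phi y^-1 k)^-1)]; this is its transport. *)
Definition twisted_inv (x : G * H) : G * H :=
  (x.1^-1, (L x.1^-1)^-1 (phi x.1^-1 (L x.1 x.2))^-1).

Lemma twisted_mulA : associative (twisted_mul phi L).
Proof.
move=> [y k] [y' k'] [y'' k'']; rewrite /twisted_mul /= !symgVK mulgA.
(* The inner [L] has cancelled; the sides agree since [phi (y' * y'') = phi y'' * phi y']. *)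
by rewrite autg_morph phiM autgM mulgA.
Qed.

Lemma twisted_mul1g : left_id (1, 1) (twisted_mul phi L).
Proof.
by move=> [y k]; rewrite /twisted_mul /= L1 symg1 autg_one !mul1g symgK.
Qed.

Lemma twisted_mulg1 : right_id (1, 1) (twisted_mul phi L).
Proof.
move=> [y k]; rewrite /twisted_mul /= L1 symg1 !mulg1.
by rewrite (antihomomorphism1 phiM) symgK.
Qed.

Lemma twisted_mulVg : left_inverse (1, 1) twisted_inv (twisted_mul phi L).
Proof.
have phiVK y : cancel (phi y^-1) (phi y).
  by move=> k; rewrite -autgM -phiM mulVg antihomomorphism1.
move=> [y k]; rewrite /twisted_mul /= symgVK mulVg L1 invg1.
(* Writing the right factor [L y k] as [phi y (phi y^-1 (L y k))] makes both factors images under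
   [phi y] of mutually inverse elements. *)
by rewrite -{2}(phiVK y (L y k)) -autg_morph mulVg autg_one.
Qed.

Lemma twisted_mulgV : right_inverse (1, 1) twisted_inv (twisted_mul phi L).
Proof. by move=> [y k]; rewrite /twisted_mul /= symgVK !mulgV L1 invg1. Qed.

HB.instance Definition _ := gen_eqMixin (twisted_prod phiM L1).
HB.instance Definition _ := gen_choiceMixin (twisted_prod phiM L1).
HB.instance Definition _ := isGroup.Build (twisted_prod phiM L1)
  twisted_mulA twisted_mul1g twisted_mulg1 twisted_mulVg twisted_mulgV.

Definition twisted_group : Group.axioms_ (G * H) :=
  Group.on (twisted_prod phiM L1).

End TwistedProduct.

Theorem theorem4p1 (Y K : Type) (dY : digroup Y) (dK : digroup K)
    (phi_star : starG dY -> autg (starG dK))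
    (phi_circ : circG dY -> autg (circG dK))
    (Lambda : Y -> symg K) :
  antihomomorphism phi_star ->
  antihomomorphism phi_circ ->
  Lambda (digroup_one dY) = 1 ->
  exists d : digroup (Y * K),
    (forall (y y' : Y) (k k' : K),
      (y, k) *[d] (y', k') =
        (y *[dY] y',
         (Lambda (y *[dY] y'))^-1
           (phi_star y' (Lambda y k) *[dK] Lambda y' k'))) /\
    (forall (y y' : Y) (k k' : K),
      (y, k) \o[d] (y', k') =
        (y \o[dY] y', phi_circ y' k \o[dK] k')).
Proof.
move=> starM circM L1.
pose cs := @twisted_group (starG dY) (starG dK) phi_star Lambda starM L1.
pose cc := @twisted_group (circG dY) (circG dK) phi_circ (fun=> 1) circM erefl.
have eq1 : @one (Group.Pack cs) = @one (Group.Pack cc).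
  exact: (f_equal2 pair (same_one dY) (same_one dK)).
exists (Digroup eq1); split=> y y' k k' //.
(* Inverses in [symg] come from a choice and do not compute, so [1^-1 = 1] has to be rewritten
   here. *)
by rewrite {1}/circ /= /mul /= /twisted_mul /= invg1.
Qed.
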